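(* The ratio $h_g(G)/|G|$ is bounded by a function of $g$ and $\omega(G)$ on even hole-free graphs: there is a function $\varphi$ such that for every integer $g$ and every (non-empty) even hole-free graph $G$ we have $h_g(G)\leq\varphi(g,\omega(G))\,|G|$.
   Context: All graphs are finite, simple and undirected. $|G|$ is the number of vertices of $G$ and $\omega(G)$ its clique number. A hole is an induced cycle of length at least $4$; a graph is even hole-free if it has no hole of even length. $h_g(G)$ denotes the number of holes of length $g$ in $G$ (so $h_g(G)=0$ if $g\leq 3$). *)

(* Defs.v *)
From mathcomp Require Import all_boot all_order all_algebra.

Set Implicit Arguments.
Unset Strict Implicit.
Unset Printing Implicit Defensive.

(* A finite simple undirected graph is a symmetric irreflexive adjacency
   relation [e : rel T] on its vertex type [T : finType]; both properties are
   hypotheses of the theorem, not of the definitions below. *)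
Section Graph.
Variables (T : finType) (e : rel T).

Definition is_clique (K : {set T}) : bool :=
  [forall x in K, forall y in K, (x != y) ==> e x y].

Definition clique_number : nat := \max_(K : {set T} | is_clique K) #|K|.

(* An induced cycle is identified with its vertex set [S]: the vertices of [S]
   can be listed as a closed walk without repetition, and every edge inside [S]
   joins two cyclically consecutive vertices of that list. *)
Definition is_induced_cycle (S : {set T}) : bool :=
  [exists c : #|S|.-tuple T,
    [&& [set x in c] == S, ucycleb e c &
        [forall x in S, forall y in S,
          e x y ==> (next c x == y) || (next c y == x)]]].

Definition is_hole (S : {set T}) : bool := (4 <= #|S|) && is_induced_cycle S.

Definition even_hole_free : bool :=
  ~~ [exists S : {set T}, is_hole S && ~~ odd #|S|].

Definition num_holes (g : int) : nat :=
  #|[set S : {set T} | is_hole S & Posz #|S| == g]|.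

End Graph.

(* Main.v *)
(** Two stable sets of an even hole-free graph induce a forest, so they span fewer
edges than vertices. This bounds the degeneracy by a function of the clique number:
in a subgraph of largest minimum degree d, which is d-degenerate, the back
neighbourhood of a vertex has smaller cliques, hence by induction few edges, and
this local sparsity yields, through a random process in the manner of Martinsson
and Steiner, a random stable set containing each vertex with probability at least
5/(2d). Two independent copies of it span too many edges on average.

For fixed l, the number of induced x-y paths with l inner vertices is then bounded:
two disjoint anticomplete ones would form an even hole, so by degeneracy a bounded
set of vertices meets all of them, and one splits the paths there. A hole of length
g through a vertex v of small degree is an induced path of this kind between two
neighbours of v; deleting v and iterating gives the theorem. *)
Require Import Defs.
From mathcomp Require Import all_boot all_order all_algebra.
From mathcomp Require Import zify ring lra.
Import Order.TTheory GRing.Theory Num.Theory.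

Set Implicit Arguments.
Unset Strict Implicit.
Unset Printing Implicit Defensive.

(** * Shortest cycles and bipartite induced subgraphs *)

Section Forest.
Variables (T : finType) (e : rel T).
Hypotheses (esym : symmetric e) (eirr : irreflexive e).

Definition deg (W : {set T}) (v : T) : nat := \sum_(u in W) e v u.

Lemma deg_card W v : deg W v = #|[set u in W | e v u]|.
Proof.
rewrite /deg -sum1_card big_mkcond [RHS]big_mkcond /=.
by apply: eq_bigr => u _; rewrite inE; case: (u \in W); case: (e v u).
Qed.

Lemma deg_subset (A B : {set T}) v : A \subset B -> deg A v <= deg B v.
Proof.
move=> sAB; rewrite !deg_card; apply/subset_leq_card/subsetP => u.
by rewrite !inE => /andP[/(subsetP sAB) -> ->].
Qed.

Lemma ucycle_prefix x y p1 p2 :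
  path e x (p1 ++ y :: p2) -> uniq (x :: p1 ++ y :: p2) -> e x y ->
  ucycleb e (x :: rcons p1 y).
Proof.
rewrite -cat_rcons cat_path -cat_cons cat_uniq => /andP[pth _] /andP[un _] exy.
by rewrite /ucycleb un andbT [cycle _ _]rcons_path pth last_rcons esym.
Qed.

Lemma mem_prefix (x y : T) p1 p2 :
  {subset x :: rcons p1 y <= x :: p1 ++ y :: p2}.
Proof. by move=> u up; rewrite -cat_rcons -cat_cons mem_cat up. Qed.

(** On a longest path in [W], all neighbours in [W] of the first vertex lie on the path; there are
    at least two, so one of them closes a cycle. *)
Lemma min_deg2_ucycle (W : {set T}) :
  W != set0 -> (forall v, v \in W -> 1 < deg W v) ->
  exists c : seq T, [/\ ucycleb e c, {subset c <= W} & 2 < size c].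
Proof.
case/set0Pn=> x0 x0W degW.
pose P n := [exists s : n.-tuple T, [&& sorted e s, uniq s & all (mem W) s]].
have P1 : exists n, P n.
  by exists 1; apply/existsP; exists [tuple x0]; rewrite /= x0W.
have Pmax n : P n -> n <= #|T|.
  case/existsP=> s /and3P[_ us _]; rewrite -(size_tuple s) -(card_uniqP us).
  exact: max_card.
case: (ex_maxnP P1 Pmax) => n /existsP[[s /= /eqP sz] /and3P[]] /=.
case: s sz => [|x p] sz pth us sW nmax.
  have /nmax : P 1 by apply/existsP; exists [tuple x0]; rewrite /= x0W.
  by rewrite -sz.
have nbr y : y \in W -> e x y -> y \in p.
  move=> yW exy; apply/negPn/negP => yp.
  have yx : y != x by apply: contraTneq exy => ->; rewrite eirr.
  have /nmax : P n.+1; last by rewrite ltnn.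
  have szy : size [:: y, x & p] == n.+1 by rewrite /= -sz.
  apply/existsP; exists (Tuple szy) => /=.
  rewrite /= in pth us sW *.
  by rewrite pth esym exy /= inE negb_or yx yp us yW.
have xW : x \in W by case/andP: sW.
have := degW x xW; rewrite deg_card => /card_gt1P[y1 [y2 []]].
rewrite !inE => /andP[W1 e1] /andP[W2 e2] ne.
(* Positive index in [p] means that [y] is not the second vertex of the path, so the closed cycle
   has at least three vertices. *)
have far : exists y, [/\ y \in p, e x y & 0 < index y p].
  case i1 : (0 < index y1 p); first by exists y1; split=> //; apply: nbr.
  exists y2; split=> //; first exact: nbr.
  rewrite lt0n; apply: contraNneq ne => i2.
  rewrite -(nth_index x (nbr _ W1 e1)) -[X in _ == X](nth_index x (nbr _ W2 e2)).
  by rewrite i2; move: i1; rewrite lt0n => /negbFE/eqP ->.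
case: far => y [yp exy iy].
have [p1 [p2 pE]] : exists p1 p2, p = p1 ++ y :: p2.
  by case/splitPr: yp => p1 p2; exists p1, p2.
case: p1 pE => [|z p1] pE; first by rewrite pE /= eqxx in iy.
rewrite {}pE {nbr} in pth us sW.
exists (x :: rcons (z :: p1) y); split; last by rewrite /= size_rcons.
- exact: (ucycle_prefix pth us exy).
- by move=> u up; apply: (allP sW); apply: mem_prefix up.
Qed.

(** A chord [x y] would close the stretch of the cycle from [x] to [y] into a shorter cycle. *)
Lemma min_ucycle_induced (W : {set T}) (c : seq T) :
  ucycleb e c -> {subset c <= W} -> 2 < size c ->
  (forall c', ucycleb e c' -> {subset c' <= W} -> 2 < size c' ->
     size c <= size c') ->
  {in c &, forall x y, e x y -> (next c x == y) || (next c y == x)}.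
Proof.
move=> /andP[cyc uc] cW sc cmin x y xc yc exy.
case: (rot_to xc) => i p rp.
rewrite -!(next_rot i uc) rp.
have up : uniq (x :: p) by rewrite -rp rot_uniq.
have cp : cycle e (x :: p) by rewrite -rp rot_cycle.
have sp : size (x :: p) = size c by rewrite -rp size_rot.
have yx : y != x by apply: contraTneq exy => ->; rewrite eirr.
have yp : y \in p.
  by move: yc; rewrite -(mem_rot i) rp inE (negbTE yx).
have pW : {subset x :: p <= W} by move=> u; rewrite -rp mem_rot => /cW.
have [p1 [p2 pE]] : exists p1 p2, p = p1 ++ y :: p2.
  by case/splitPr: yp => p1 p2; exists p1, p2.
rewrite {yp}pE in up cp sp pW *.
(* With [p1] empty, [y] follows [x] on the cycle; with [p2] empty, [x] follows [y]. Otherwise [x y]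
   is a chord. *)
case: p1 => [|a p1] in up cp sp pW *; first by rewrite /= !eqxx.
case: p2 => [|b p2] in up cp sp pW *.
  have -> : next (x :: (a :: p1) ++ [:: y]) y = x.
    rewrite -cat_cons cats1 -rot1_cons next_rot; first by rewrite /= eqxx.
    by rewrite -(rot_uniq 1) rot1_cons -cats1.
  by rewrite eqxx orbT.
suff : size c <= size (x :: rcons (a :: p1) y).
  by rewrite -sp /= size_rcons size_cat /=; lia.
apply: cmin; last by rewrite /= size_rcons.
- apply: (ucycle_prefix _ up exy (p2 := b :: p2)).
  by move: cp; rewrite [cycle _ _]rcons_path => /andP[].
- by move=> u u1; apply: pW; apply: mem_prefix u1.
Qed.

Lemma path_colour (W : {set T}) (col : pred T) :
  {in W &, forall u v, e u v -> col u != col v} ->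
  forall p x, x \in W -> {subset p <= W} -> path e x p ->
  col (last x p) = col x (+) odd (size p).
Proof.
move=> colP; elim=> [|y p IH] x xW pW /=; first by rewrite addbF.
case/andP=> exy pth; have yW : y \in W by apply: pW; rewrite mem_head.
rewrite IH // => [|u up]; last by apply: pW; rewrite inE up orbT.
by have := colP _ _ xW yW exy; case: (col x); case: (col y); case: (odd _).
Qed.

(** If all degrees were at least 2, [W] would contain a cycle. A shortest one is induced, and the
    2-colouring makes its length even, hence at least 4: an even hole. *)
Lemma bipartite_deg_le1 (W : {set T}) (col : pred T) :
  even_hole_free e -> W != set0 ->
  {in W &, forall u v, e u v -> col u != col v} ->
  exists2 v, v \in W & deg W v <= 1.
Proof.
move=> ehf W0 colP; apply/exists_inP; apply: contraT.
rewrite negb_exists_in => /forall_inP degW; exfalso.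
have {}degW v : v \in W -> 1 < deg W v by move=> /degW; rewrite -ltnNge.
pose P n := [exists c : n.-tuple T, [&& ucycleb e c, all (mem W) c & 2 < n]].
have PP c : ucycleb e c -> {subset c <= W} -> 2 < size c -> P (size c).
  move=> uc cW sc; apply/existsP; exists (in_tuple c).
  by rewrite uc sc andbT /=; apply/allP => u /cW.
have exP : exists n, P n.
  by have [c [uc cW sc]] := min_deg2_ucycle W0 degW; exists (size c); apply: PP.
case: (ex_minnP exP) => n /existsP[c /and3P[uc /allP cW n3]] nmin.
have szc := size_tuple c.
have ind := @min_ucycle_induced W c uc cW.
have {}ind : {in c &, forall x y, e x y -> (next c x == y) || (next c y == x)}.
  by apply: ind; rewrite szc // => c' uc' cW' sc'; apply/nmin/PP.
have /andP[cyc un] := uc.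
have card : #|[set x in c]| = n by rewrite cardsE (card_uniqP un).
have evn : ~~ odd n.
  rewrite -szc; case: (tval c) cyc cW => [//|x p] cyc cW.
  have pW : {subset rcons p x <= W}.
    by move=> u; rewrite mem_rcons => /cW.
  have := path_colour colP (cW x (mem_head _ _)) pW cyc.
  by rewrite last_rcons size_rcons /=; case: (col x); case: (odd _).
case/negP: ehf; apply/existsP; exists [set x in c].
rewrite /is_hole card evn andbT; apply/andP; split; first by move: n3 evn; lia.
have sz' : size c == #|[set x in c]| by rewrite card szc.
apply/existsP; exists (Tuple sz'); apply/and3P; split=> //=.
apply/forall_inP=> x; rewrite inE => xc.
apply/forall_inP=> y; rewrite inE => yc.
by apply/implyP; apply: ind.
Qed.

End Forest.

(** * Degenerate sets, and edges between two stable sets *)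

Section Degenerate.
Variables (T : finType) (e : rel T).
Hypotheses (esym : symmetric e) (eirr : irreflexive e).
Notation deg := (deg e).

Definition degenerate (D : nat) (W : {set T}) :=
  forall U : {set T}, U \subset W -> U != set0 ->
    exists2 v, v \in U & deg U v <= D.

Lemma degenerateW D (A B : {set T}) :
  A \subset B -> degenerate D B -> degenerate D A.
Proof. by move=> sAB dB U sUA; apply: dB; apply: subset_trans sAB. Qed.

Lemma deg_remove (W : {set T}) v u :
  v \in W -> deg W u = e u v + deg (W :\ v) u.
Proof. by move=> vW; rewrite /deg (big_setD1 v). Qed.

(** Deleting a vertex of degree at most [D] lowers the degree sum by twice its degree. *)
Lemma sum_deg_degenerate D (W : {set T}) :
  degenerate D W -> \sum_(v in W) deg W v <= 2 * D * #|W|.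
Proof.
have [n leWn] := ubnP #|W|; elim: n W leWn => // n IH W leWn dW.
have [-> | W0] := eqVneq W set0; first by rewrite big_set0.
have [v vW degv] := dW W (subxx _) W0.
have cW := cardsD1 v W; rewrite vW in cW.
have lt : #|W :\ v| < n by move: leWn; rewrite cW.
have {IH} := IH _ lt (degenerateW (subsetDl _ _) dW).
have -> : \sum_(u in W) deg W u = 2 * deg W v + \sum_(u in W :\ v) deg (W :\ v) u.
  rewrite (big_setD1 v) //= (eq_bigr _ (fun u _ => deg_remove u vW)) big_split /=.
  rewrite (eq_bigr (fun u => nat_of_bool (e v u))); last by move=> u _; rewrite esym.
  by rewrite -/(deg (W :\ v) v) addnA mul2n -addnn (deg_remove v vW) eirr.
by rewrite cW; nia.
Qed.

Definition stable (I : {set T}) := {in I &, forall u v, ~~ e u v}.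

(** Membership in [I] properly 2-colours the union, which is therefore 1-degenerate. [I] and [J] may
    overlap: a common vertex has no neighbour in either set and contributes 0. *)
Lemma edges_stable_pair (I J : {set T}) :
  even_hole_free e -> stable I -> stable J ->
  \sum_(u in I) deg J u <= #|I| + #|J|.
Proof.
move=> ehf sI sJ.
have d1 : degenerate 1 (I :|: J).
  move=> U sU U0; apply: (@bipartite_deg_le1 _ _ esym eirr U (mem I)) => //.
  move=> u v uU vU euv /=.
  have := subsetP sU _ uU; have := subsetP sU _ vU; rewrite !inE.
  case uI : (u \in I); case vI : (v \in I) => //=.
    by have := sI _ _ uI vI; rewrite euv.
  by move=> vJ uJ; have := sJ _ _ uJ vJ; rewrite euv.
have := sum_deg_degenerate d1.
have dswap : \sum_(u in I) deg J u = \sum_(u in J) deg I u.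
  rewrite /deg exchange_big /=; apply: eq_bigr => u _.
  by apply: eq_bigr => v _; rewrite esym.
have : \sum_(u in I) deg J u + \sum_(u in J) deg I u
       <= \sum_(u in I :|: J) deg (I :|: J) u.
  rewrite [X in X + _]big_mkcond [X in _ + X <= _]big_mkcond [X in _ <= X]big_mkcond.
  rewrite -big_split; apply: leq_sum => u _ /=; rewrite inE.
  have d0 (A : {set T}) : stable A -> u \in A -> deg A u = 0.
    by move=> sA uA; rewrite /deg big1 // => v vA; rewrite (negbTE (sA _ _ uA vA)).
  case uI : (u \in I); case uJ : (u \in J) => //=.
  - by rewrite (d0 I) ?(d0 J).
  - by rewrite addn0 deg_subset // subsetUr.
  - by rewrite add0n deg_subset // subsetUl.
rewrite -dswap; have [le _] := leq_card_setU I J; lia.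
Qed.

End Degenerate.

(** * A random process that selects a stable set *)

Section Process.
Local Open Scope ring_scope.
Variables (R : realFieldType) (T : finType) (e : rel T).
Hypotheses (esym : symmetric e) (eirr : irreflexive e).
Variables (c : R) (K : nat).

(* The vertices are processed one by one. A vertex [z] is selected with
   probability [prob st z], proportional to its weight; selecting it kills the
   weights of its neighbours, and skipping it scales them up, so that every weight
   is a martingale. The load [ld] of a vertex sums the selection probabilities of
   its skipped neighbours, and an overloaded vertex is never selected: this keeps
   all probabilities below [1/2]. *)
Record state := State { wt : T -> R; ld : T -> R; sel : {set T} }.

Definition prob st z := if ld st z <= K%:R then c * wt st z else 0.

Definition take_vx st z :=
  State (fun u => if e z u then 0 else wt st u) (ld st) (z |: sel st).

Definition skip_vx st z :=
  State (fun u => if e z u then wt st u / (1 - prob st z) else wt st u)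
        (fun u => if e z u then ld st u + prob st z else ld st u) (sel st).

(** The probability space stays implicit: only its expectation functional appears, so that facts
    about the process become inductions on the processed sequence. *)
Fixpoint expect (s : seq T) st (f : state -> R) : R :=
  if s is z :: s' then
    prob st z * expect s' (take_vx st z) f
    + (1 - prob st z) * expect s' (skip_vx st z) f
  else f st.

(** In the weight bound of [admissible], a load of at most [K] forces $k \le 4K$, and the mantissa
    $1-r \ge 1/2$ costs one more factor 2. *)
Definition wmax : R := 2 ^+ (4 * K).+1.
Hypotheses (c_ge0 : 0 <= c) (c_wmax : c * wmax <= 2^-1).

(* The second clause is a rational substitute for a bound of [wt u] by a power of
   [2] linear in [ld u]: the mantissa [1 - r] absorbs factors [1 - p] until the
   exponent [k] increases. *)
Definition admissible st :=
  [/\ forall u, 0 <= wt st u,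
      forall u, exists k r, [/\ 0 <= r, r <= 2^-1,
        wt st u * (1 - r) <= 2 ^+ k & k%:R / 4 + r / 2 <= ld st u],
      forall u v, u \in sel st -> e u v -> wt st v = 0
    & stable e (sel st)].

Lemma wt_le_wmax st z : admissible st -> ld st z <= K%:R -> wt st z <= wmax.
Proof.
case=> w0 /(_ z)[k [r [r0 r1 wk kl]]] _ _ lK.
have kK : (k <= 4 * K)%N.
  by rewrite -(ler_nat R) natrM; have := ltr0n R 4; lra.
have w2 : wt st z <= 2 * 2 ^+ k by have := w0 z; nra.
apply: (le_trans w2); rewrite /wmax -exprS.
by rewrite ler_eXn2l ?ltr1n.
Qed.

Lemma prob_ge0 st z : admissible st -> 0 <= prob st z.
Proof. by case=> w0 _ _ _; rewrite /prob; case: ifP => // _; apply: mulr_ge0. Qed.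

Lemma prob_le st z : admissible st -> prob st z <= c * wmax.
Proof.
move=> ad; rewrite /prob; case: ifP => [lK|_].
  by apply: ler_wpM2l => //; apply: wt_le_wmax.
by apply: mulr_ge0 => //; apply: exprn_ge0.
Qed.

Lemma prob_le_half st z : admissible st -> prob st z <= 2^-1.
Proof. by move=> ad; apply: le_trans c_wmax; apply: prob_le. Qed.

(** A positive probability means a nonzero weight, so [z] has no selected neighbour and may join the
    stable set. *)
Lemma admissible_take st z :
  admissible st -> 0 < prob st z -> admissible (take_vx st z).
Proof.
move=> ad pz; have [w0 wl ws st_] := ad.
have wz : wt st z != 0.
  by apply: contraTneq pz => wz; rewrite /prob wz mulr0 if_same ltxx.
have nz u : u \in sel st -> e u z = false.
  by move=> us; apply: contraNF wz => /(ws _ _ us) ->.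
split=> /=.
- by move=> u; case: ifP.
- move=> u; case: ifP => [_|_]; last exact: wl.
  have [k [r [r0 r1 _ kl]]] := wl u; exists k, r; split=> //.
  by rewrite mul0r exprn_ge0.
- move=> u v; rewrite !inE => /orP[/eqP-> -> // | us euv].
  by rewrite (ws _ _ us euv) if_same.
- move=> u v; rewrite !inE => /orP[/eqP->|us] /orP[/eqP->|vs].
  + by rewrite eirr.
  + by rewrite esym nz.
  + by rewrite nz.
  + exact: st_.
Qed.

Lemma admissible_skip st z : admissible st -> admissible (skip_vx st z).
Proof.
move=> ad; have [w0 wl ws st_] := ad.
have p0 := prob_ge0 z ad; have p1 := prob_le_half z ad.
set p := prob st z in p0 p1.
have q0 : 0 < 1 - p by lra.
split=> //=; rewrite -/p.
- by move=> u; case: ifP => // _; apply: divr_ge0 => //; apply: ltW.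
- move=> u; case: ifP => [_|_]; last exact: wl.
  have [k [r [r0 r1 wk kl]]] := wl u; have wu := w0 u.
  (* Skipping raises [r] by [p]; beyond $1/2$, the exponent takes over $1/2$. Either way $k/4+r/2$
     grows by $p/2$, while the load grows by $p$. *)
  have [rp|rp] := leP (r + p) 2^-1.
    exists k, (r + p); split=> //; [lra| |lra].
    apply: le_trans wk; rewrite mulrAC ler_pdivrMr // -mulrA.
    by apply: ler_wpM2l => //; nra.
  exists k.+1, (r + p - 2^-1); split; [lra|lra| |rewrite -natr1; lra].
  rewrite mulrAC ler_pdivrMr // exprS.
  apply: (@le_trans _ _ (2 * (wt st u * (1 - r)) * (1 - p))).
    have -> : 2 * (wt st u * (1 - r)) * (1 - p) = wt st u * (2 * (1 - r) * (1 - p)) by ring.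
    (* Without the weight, this is $(1-2r)(1-2p) \ge 0$. *)
    by apply: ler_wpM2l => //; nra.
  by apply: ler_wpM2r; [apply: ltW | apply: ler_wpM2l].
- move=> u v us euv; rewrite (ws _ _ us euv) mul0r if_same //.
Qed.

(** The selecting branch is compared only at positive probability, since otherwise [take_vx st z]
    may fail to be admissible. *)
Lemma expect_step s st z f g : admissible st ->
  (0 < prob st z -> expect s (take_vx st z) f <= expect s (take_vx st z) g) ->
  expect s (skip_vx st z) f <= expect s (skip_vx st z) g ->
  expect (z :: s) st f <= expect (z :: s) st g.
Proof.
move=> ad ft fs /=; have p0 := prob_ge0 z ad; have p1 := prob_le_half z ad.
apply: lerD; last by apply: ler_wpM2l => //; lra.
have [pz|pz] := ltP 0 (prob st z); first by apply: ler_wpM2l => //; apply: ft.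
by have -> : prob st z = 0 by [lra]; rewrite !mul0r.
Qed.

Lemma expect_le s st f g : admissible st ->
  (forall st', admissible st' -> f st' <= g st') -> expect s st f <= expect s st g.
Proof.
elim: s st => [|z s IH] st ad fg; first exact: fg.
apply: expect_step => // [pz|]; apply: IH => //.
  exact: admissible_take.
exact: admissible_skip.
Qed.

Lemma expect_cst s st a : expect s st (fun=> a) = a.
Proof. by elim: s st => //= z s IH st; rewrite !IH; ring. Qed.

Lemma expectD s st f g :
  expect s st (fun x => f x + g x) = expect s st f + expect s st g.
Proof. by elim: s st => //= z s IH st; rewrite !IH; ring. Qed.

Lemma expectZ s st a f : expect s st (fun x => a * f x) = a * expect s st f.
Proof. by elim: s st => //= z s IH st; rewrite !IH; ring. Qed.

Lemma expect_sum s st (A : {set T}) (F : T -> state -> R) :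
  expect s st (fun x => \sum_(u in A) F u x) = \sum_(u in A) expect s st (F u).
Proof.
elim: s st => //= z s IH st.
by rewrite !IH !mulr_sumr -big_split.
Qed.

Lemma expect_cat s1 s2 st f :
  expect (s1 ++ s2) st f = expect s1 st (fun st' => expect s2 st' f).
Proof. by elim: s1 st => //= z s IH st; rewrite !IH. Qed.

Lemma expect_wt s st u : admissible st -> expect s st (fun x => wt x u) = wt st u.
Proof.
elim: s st => //= z s IH st ad.
have p0 := prob_ge0 z ad; have p1 := prob_le_half z ad.
rewrite (IH _ (admissible_skip z ad)) /=.
have -> : prob st z * expect s (take_vx st z) (fun x => wt x u)
        = prob st z * (if e z u then 0 else wt st u).
  have [pz|pz] := ltP 0 (prob st z); first by rewrite IH //; apply: admissible_take.
  by have -> : prob st z = 0 by [lra]; rewrite !mul0r.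
by case: ifP => _; field; lra.
Qed.

(** The product of the two weights keeps its mean, or loses some, unless [z] is adjacent to both [u]
    and [v]; such a step inflates it by at most $1/(1-p)$ with $p \le c\cdot$[wmax]. *)
Lemma expect_wtM s st u v : admissible st ->
  (1 - c * wmax) ^+ count (fun z => e z u && e z v) s
    * expect s st (fun x => wt x u * wt x v) <= wt st u * wt st v.
Proof.
elim: s st => [|z s IH] st ad; first by rewrite /= mul1r.
have p0 := prob_ge0 z ad; have p1 := prob_le_half z ad; have pc := prob_le z ad.
have [w0 _ _ _] := ad; have w00 := mulr_ge0 (w0 u) (w0 v).
have c1 := c_wmax; set eta := c * wmax in IH c1 pc *.
rewrite /= exprD; set t := count _ s in IH *.
have := IH _ (admissible_skip z ad).
have {IH} : prob st z * ((1 - eta) ^+ t * expect s (take_vx st z) (fun x => wt x u * wt x v))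
  <= prob st z * (if e z u || e z v then 0 else wt st u * wt st v).
  have [pz|pz] := ltP 0 (prob st z); last first.
    by have -> : prob st z = 0 by [lra]; rewrite !mul0r.
  apply: ler_wpM2l => //; apply: le_trans (IH _ (admissible_take ad pz)) _ => /=.
  by case: (e z u); case: (e z v); rewrite /= ?(mul0r, mulr0).
move: (expect s (take_vx st z) _) (expect s (skip_vx st z) _) => Et Es /=.
set p := prob st z in p0 p1 pc *; set A := (1 - eta) ^+ t => h1 h2.
have A0 : 0 <= A by apply: exprn_ge0; lra.
have q0 : 0 < 1 - p by lra.
rewrite -mulrA mulrDr.
have -> : A * (p * Et) = p * (A * Et) by ring.
have -> : A * ((1 - p) * Es) = (1 - p) * (A * Es) by ring.
move: (A * Et) (A * Es) h1 h2 => {Et Es A A0} Et Es h1 h2.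
have h3 := ler_wpM2l (ltW q0) h2.
case zu : (e z u) h1 h3; case zv : (e z v) => /= h1 h3;
  rewrite ?expr0 ?expr1 ?mul1r in h1 h3 *.
- set W := (1 - p) * (_ / _ * _) in h3.
  have W1 : (1 - p) * W = wt st u * wt st v by rewrite /W; field; lra.
  have W0 : 0 <= W by rewrite /W !mulr_ge0 ?invr_ge0 //; lra.
  rewrite -W1; apply: (@le_trans _ _ ((1 - eta) * W)).
    by apply: ler_wpM2l; lra.
  by apply: ler_wpM2r; lra.
- have W1 : (1 - p) * (wt st u / (1 - p) * wt st v) = wt st u * wt st v by field; lra.
  by rewrite W1 in h3; lra.
- have W1 : (1 - p) * (wt st u * (wt st v / (1 - p))) = wt st u * wt st v by field; lra.
  by rewrite W1 in h3; lra.
- by lra.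
Qed.

(** If [z] is adjacent to [v], the skipping probability cancels the scaling of the weight of [v], so
    the load increment contributes exactly [wt x v * prob x z]. *)
Lemma expect_wt_ld_rcons s z st v : admissible st ->
  expect (rcons s z) st (fun x => wt x v * ld x v)
  = expect s st (fun x => wt x v * ld x v)
    + (if e z v then expect s st (fun x => wt x v * prob x z) else 0).
Proof.
elim: s st => [|y s IH] st ad /=.
  have p0 := prob_ge0 z ad; have p1 := prob_le_half z ad.
  by case: ifP => _; field; lra.
have p0 := prob_ge0 y ad; have p1 := prob_le_half y ad.
rewrite (IH _ (admissible_skip y ad)).
have [py|py] := ltP 0 (prob st y).
  by rewrite (IH _ (admissible_take ad py)); case: ifP => _; ring.
have -> : prob st y = 0 by lra.
by case: ifP => _; ring.
Qed.

Definition start := State (fun=> 1) (fun=> 0) set0.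

Lemma admissible_start : admissible start.
Proof.
split=> //= [u|u v|u v]; rewrite ?inE //.
by exists 0%N, 0; split; lra.
Qed.

(** A neighbour [z] that is not bad shares few neighbours with [v], so the two weights are almost
    uncorrelated and it adds at most $2c$. A bad one adds at most the maximal probability
    $c\cdot$[wmax], as the weight of [v] has mean 1. *)
Lemma expect_wt_ld s v (bad : pred T) (B : nat) :
  B%:R * (c * wmax) <= 2^-1 ->
  (forall z, z \in s -> e z v -> ~~ bad z ->
     (count (fun y => e y z && e y v) s <= B)%N) ->
  expect s start (fun x => wt x v * ld x v)
  <= 2 * c * (count (fun z => e z v) s)%:R
     + c * wmax * (count (fun z => e z v && bad z) s)%:R.
Proof.
move=> hB; have st0 := admissible_start; have wm0 : 0 <= wmax by apply: exprn_ge0.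
have c1 := c_wmax.
have cw0 : 0 <= c * wmax by apply: mulr_ge0.
elim/last_ind: s => [|s z IH] hs; first by rewrite /= !mulr0 addr0.
have cmon (a : pred T) : (count a s <= count a (rcons s z))%N.
  by rewrite -cats1 count_cat leq_addr.
have {IH} : expect s start (fun x => wt x v * ld x v)
  <= 2 * c * (count (fun z => e z v) s)%:R
     + c * wmax * (count (fun z => e z v && bad z) s)%:R.
  apply: IH => y ys eyv nb; apply: leq_trans (cmon _) (hs y _ eyv nb).
  by rewrite mem_rcons inE ys orbT.
rewrite expect_wt_ld_rcons // -cats1 !count_cat /= !addn0 !natrD.
case ezv : (e z v) => /=; last by rewrite !addr0.
set A := expect s start _; set n1 := (count _ s)%:R; set n2 := (count _ s)%:R.
move=> IH.
case bz : (bad z) => /=.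
  suff : expect s start (fun x => wt x v * prob x z) <= c * wmax.
    by have c0 := c_ge0; rewrite !mulrDr !mulr1; lra.
  have -> : c * wmax = expect s start (fun x => c * wmax * wt x v).
    by rewrite expectZ expect_wt //= mulr1.
  apply: expect_le => // st ad; rewrite mulrC; apply: ler_wpM2r.
    by case: ad.
  exact: prob_le.
suff : expect s start (fun x => wt x v * prob x z) <= 2 * c.
  by rewrite addr0 !mulrDr !mulr1; lra.
apply: (@le_trans _ _ (expect s start (fun x => c * (wt x z * wt x v)))).
  apply: expect_le => // st [w0 _ _ _]; rewrite mulrC mulrA.
  apply: ler_wpM2r => //; rewrite /prob; case: ifP => // _.
  exact: mulr_ge0.
rewrite expectZ mulrC; apply: ler_wpM2r => //.
have := expect_wtM s z v st0; rewrite /= mulr1.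
set t := count _ s; set E := expect s start _ => hE.
have E0 : 0 <= E.
  rewrite -(expect_cst s start 0); apply: expect_le => // st [w0 _ _ _].
  exact: mulr_ge0.
have tB : (t <= B)%N.
  apply: leq_trans (cmon _) (hs z _ ezv _); last by rewrite bz.
  by rewrite mem_rcons mem_head.
(* Bernoulli's inequality: at most [B] common neighbours cost at most a factor 2. *)
have bern : forall n, 1 - n%:R * (c * wmax) <= (1 - c * wmax) ^+ n.
  elim=> [|n IHn]; first by rewrite mul0r subr0.
  rewrite exprS -natr1; have n0 : 0 <= n%:R :> R by [].
  have q0 : 0 <= 1 - c * wmax by lra.
  apply: le_trans (ler_wpM2l q0 IHn).
  have := mulr_ge0 n0 (mulr_ge0 cw0 cw0); lra.
have tB' : t%:R * (c * wmax) <= 2^-1.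
  by apply: le_trans hB; apply: ler_wpM2r => //; rewrite ler_nat.
have half : 2^-1 <= (1 - c * wmax) ^+ t by apply: le_trans (bern t); lra.
have := ler_wpM2r E0 half; lra.
Qed.

(** Markov's inequality weighted by [wt]: pointwise, [prob] is at least $c\,wt\,(1-ld/K)$, which is
    negative or zero for an overloaded vertex. *)
Lemma expect_prob s v :
  (0 < K)%N -> expect s start (fun x => wt x v * ld x v) <= K%:R / 2 ->
  c / 2 <= expect s start (prob^~ v).
Proof.
move=> K0 hL; have st0 := admissible_start.
have K1 : 0 < K%:R :> R by rewrite ltr0n.
apply: (@le_trans _ _ (expect s start (fun x => c * wt x v + - (c / K%:R) * (wt x v * ld x v)))).
  rewrite expectD !expectZ expect_wt //= mulr1.
  have ck : 0 <= c / K%:R by apply: divr_ge0 => //; apply: ltW.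
  have := ler_wpM2l ck hL.
  have -> : c / K%:R * (K%:R / 2) = c / 2 by field; rewrite gt_eqF.
  lra.
apply: expect_le => // st ad_; have [w0 _ _ _] := ad_.
have -> : c * wt st v + - (c / K%:R) * (wt st v * ld st v)
        = c * wt st v * (1 - ld st v / K%:R) by field; rewrite gt_eqF.
rewrite /prob; have cw := mulr_ge0 c_ge0 (w0 v).
have l0 : 0 <= ld st v.
  case: ad_ => _ /(_ v)[k [r [r0 _ _ kl]]] _ _; have := ler0n R k; lra.
case: ifP => lK.
  have : 0 <= ld st v / K%:R by apply: divr_ge0 => //; apply: ltW.
  nra.
have : 1 <= ld st v / K%:R.
  by rewrite ler_pdivlMr // mul1r; move/negbT: lK; rewrite -ltNge => /ltW.
nra.
Qed.

Lemma expect_sel_notin u s st :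
  u \notin s -> expect s st (fun x => (u \in sel x)%:R) = (u \in sel st)%:R.
Proof.
elim: s st => //= z s IH st; rewrite inE negb_or => /andP[uz us].
by rewrite !IH //= !inE (negbTE uz) /=; ring.
Qed.

Lemma expect_sel s1 u s2 : u \notin s2 ->
  expect s1 start (prob^~ u) <= expect (s1 ++ u :: s2) start (fun x => (u \in sel x)%:R).
Proof.
move=> us2; rewrite expect_cat; apply: expect_le => [|st ad]; first exact: admissible_start.
rewrite /= !expect_sel_notin //= !inE eqxx mulr1 lerDl mulr_ge0 //.
by have := prob_le_half u ad; lra.
Qed.

(** [x u] is the probability that [u] is selected. The final clause, that [x] obeys every linear
    inequality valid for all stable sets, is how the distribution is used later. *)
Lemma fractional_stable (s : seq T) (d b B : nat) :
  uniq s -> (0 < K)%N -> B%:R * (c * wmax) <= 2^-1 ->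
  2 * c * d%:R + c * wmax * b%:R <= K%:R / 2 ->
  (forall s1 v s2, s = s1 ++ v :: s2 -> exists bad : pred T,
     [/\ forall z, z \in s1 -> e z v -> ~~ bad z ->
            (count (fun y => e y z && e y v) s1 <= B)%N,
         (count (fun z => e z v && bad z) s1 <= b)%N
       & (count (fun z => e z v) s1 <= d)%N]) ->
  exists x : T -> R,
    (forall v, v \in s -> c / 2 <= x v) /\
    forall (a : T -> R) g,
      (forall I, stable e I -> \sum_(u in I) a u <= g) -> \sum_u x u * a u <= g.
Proof.
move=> us K0 hB hK hs; have st0 := admissible_start.
exists (fun u => expect s start (fun x => (u \in sel x)%:R)); split.
  move=> v vs; have [s1 [s2 sE]] : exists s1 s2, s = s1 ++ v :: s2.
    by case/splitPr: vs => s1 s2; exists s1, s2.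
  have [bad [hbad hb hd]] := hs _ _ _ sE.
  have vs2 : v \notin s2 by move: us; rewrite sE cat_uniq /= => /and4P[].
  rewrite sE; apply: le_trans (expect_sel s1 vs2).
  apply: expect_prob => //; apply: le_trans (expect_wt_ld hB hbad) _.
  apply: le_trans hK; apply: lerD; apply: ler_wpM2l; rewrite ?ler_nat //.
    exact: mulr_ge0.
  by apply: mulr_ge0 => //; apply: exprn_ge0.
move=> a g ag.
have -> : \sum_u expect s start (fun x => (u \in sel x)%:R) * a u
   = expect s start (fun x => \sum_(u in [set: T]) a u * (u \in sel x)%:R).
  rewrite expect_sum; apply: eq_big => [u|u _]; first by rewrite inE.
  by rewrite expectZ mulrC.
rewrite -[X in _ <= X](expect_cst s start); apply: expect_le => // st [_ _ _ sst].
apply: le_trans (ag _ sst); rewrite [X in _ <= X]big_mkcond /=.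
rewrite le_eqVlt; apply/orP; left; apply/eqP.
apply: eq_big => [u|u _]; first by rewrite inE.
by case: ifP => _; rewrite ?mulr1 ?mulr0.
Qed.

End Process.

(** * Degeneracy bounded by the clique number *)

Section DegeneracyBound.
Variables (T : finType) (e : rel T).
Hypotheses (esym : symmetric e) (eirr : irreflexive e).
Notation deg := (deg e).

Lemma deg_seq (s : seq T) v : uniq s -> deg [set x in s] v = count (fun z => e z v) s.
Proof.
move=> us; rewrite -sum1_count /deg [RHS]big_mkcond /= big_uniq //=.
by apply: eq_big => [u|u _]; rewrite ?inE // esym; case: (e u v).
Qed.

Lemma degenerate_order D (W : {set T}) : degenerate e D W ->
  exists s : seq T, [/\ uniq s, [set x in s] = W &
    forall s1 v s2, s = s1 ++ v :: s2 -> count (fun z => e z v) s1 <= D].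
Proof.
have [n leWn] := ubnP #|W|; elim: n W leWn => // n IH W leWn dW.
have [-> | W0] := eqVneq W set0.
  exists [::]; split=> [|| [|]] //; apply/setP => u; rewrite !inE //.
have [v vW degv] := dW W (subxx _) W0.
have lt : #|W :\ v| < n by move: leWn; rewrite (cardsD1 v W) vW.
have [s [us sW so]] := IH _ lt (degenerateW (subsetDl _ _) dW).
have sE x : (x \in s) = (x \in W :\ v) by rewrite -sW inE.
exists (rcons s v); split.
- by rewrite rcons_uniq us sE !inE eqxx.
- apply/setP => x; rewrite inE mem_rcons inE sE !inE.
  by case: eqVneq => // ->; rewrite vW.
- move=> s1 x s2; case/lastP: s2 => [|s2 y].
    rewrite cats1 => /rcons_inj[<- <-].
    by rewrite -deg_seq // sW; apply: leq_trans degv; rewrite deg_subset // subsetDl.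
  by rewrite -rcons_cons -rcons_cat => /rcons_inj[sE' _]; apply: (so _ _ s2).
Qed.

(** Take [d] to be the largest minimum degree over nonempty subsets of [U]; a subset violating
    [d]-degeneracy would have a larger one. *)
Lemma max_min_deg N (U : {set T}) :
  U != set0 -> (forall v, v \in U -> N < deg U v) ->
  exists d (W : {set T}), [/\ N < d, W \subset U, W != set0,
    forall v, v \in W -> d <= deg W v & degenerate e d W].
Proof.
move=> U0 hU.
pose P m := [exists W : {set T},
  [&& W \subset U, W != set0 & [forall v in W, m <= deg W v]]].
have P1 : P N.+1 by apply/existsP; exists U; rewrite subxx U0; apply/forall_inP.
have Pmax m : P m -> m <= #|T|.
  case/existsP => W /and3P[_ /set0Pn[v vW] /forall_inP/(_ v vW)].
  by move=> /leq_trans; apply; rewrite deg_card; apply: max_card.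
have [d /existsP[W /and3P[WU W0 /forall_inP hW]] dmax] := ex_maxnP (ex_intro (fun m => P m) _ P1) Pmax.
exists d, W; split=> //; first exact: dmax.
move=> V VW V0; apply/exists_inP; apply: contraT.
rewrite negb_exists_in => /forall_inP hV.
suff /dmax : P d.+1 by rewrite ltnn.
apply/existsP; exists V; rewrite (subset_trans VW WU) V0.
by apply/forall_inP => v /hV; rewrite -ltnNge.
Qed.

(** Relative to a set, so that the induction can pass to neighbourhoods inside a fixed graph. *)
Definition cliques_le k (S : {set T}) :=
  forall Q : {set T}, Q \subset S -> is_clique e Q -> #|Q| <= k.

Lemma cliques_leW k (A B : {set T}) :
  A \subset B -> cliques_le k B -> cliques_le k A.
Proof. by move=> sAB cB Q sQ; apply: cB; apply: subset_trans sAB. Qed.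

Lemma cliques_le_nbr k (W A : {set T}) v : cliques_le k.+1 W -> v \in W ->
  A \subset W -> (forall u, u \in A -> e u v) -> cliques_le k A.
Proof.
move=> cW vW AW Av Q QA clQ.
have vQ : v \notin Q.
  by apply/negP => /(subsetP QA) /Av; rewrite eirr.
have /cW : v |: Q \subset W.
  by rewrite subUset sub1set vW (subset_trans QA AW).
rewrite cardsU1 vQ add1n ltnS; apply.
apply/forall_inP => x; rewrite !inE => xQ; apply/forall_inP => y; rewrite !inE => yQ.
apply/implyP => xy.
case/orP: xQ xy => [/eqP->|xQ]; case/orP: yQ => [/eqP->|yQ] xy.
- by rewrite eqxx in xy.
- by rewrite esym Av // (subsetP QA).
- by rewrite Av // (subsetP QA).
- by move: clQ => /forall_inP/(_ x xQ)/forall_inP/(_ y yQ)/implyP; apply.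
Qed.

(** The bad vertices alone contribute [B'] each to a degree sum of at most $2Dd$, and $d <
    10MB'$. *)
Lemma few_bad D (A : {set T}) d B' M (bad : pred T) :
  degenerate e D A -> #|A| <= d -> d < B' * (10 * M) -> 
  (forall z, z \in A -> bad z -> B' <= deg A z) ->
  #|[set z in A | bad z]| <= 20 * M * D.
Proof.
move=> dA Ad dB hbad.
have h1 := sum_deg_degenerate esym eirr dA.
have h2 : #|[set z in A | bad z]| * B' <= \sum_(v in A) deg A v.
  rewrite -sum_nat_const big_mkcond [X in _ <= X]big_mkcond /=.
  apply: leq_sum => z _; rewrite inE; case zA : (z \in A) => //=.
  by case: ifP => // /hbad; apply.
have d0 : 0 < d \/ A = set0.
  by case: posnP Ad => [->|]; [rewrite leqn0 cards_eq0 => /eqP; right | left].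
case: d0 => [d0|->]; last first.
  by rewrite (_ : [set z in set0 | bad z] = set0) ?cards0 //; apply/setP=> z; rewrite !inE.
set n := #|_| in h2 *; have {h1 h2} h : n * B' <= 2 * D * d.
  by apply: leq_trans h2 _; apply: leq_trans h1 _; rewrite leq_mul2l Ad orbT.
rewrite -(leq_pmul2r d0).
by apply: (@leq_trans (n * (B' * (10 * M)))); [rewrite leq_mul2l ltnW ?orbT | nia].
Qed.

Local Open Scope ring_scope.

(* Testing [x] against the pair inequality [edges_stable_pair] in both
   coordinates: the left side has [5/2] edges per vertex, the right side 2. *)
Lemma no_heavy_fractional_stable (d : nat) (W : {set T}) (x : T -> rat) :
  even_hole_free e -> (0 < d)%N -> W != set0 ->
  (forall v, v \in W -> (d <= deg W v)%N) ->
  (forall v, v \in W -> 5 / d%:R / 2 <= x v) ->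
  (forall (a : T -> rat) g, (forall I, stable e I -> \sum_(u in I) a u <= g) ->
     \sum_u x u * a u <= g) -> False.
Proof.
move=> ehf d0 W0 hW hx hfrac.
have d1 : 0 < d%:R :> rat by rewrite ltr0n.
(* Extending test functions by 0 outside [W] leaves only stable subsets of [W] to consider. *)
have {}hfrac (a : T -> rat) g :
    (forall I : {set T}, I \subset W -> stable e I -> \sum_(u in I) a u <= g) ->
    \sum_(u in W) x u * a u <= g.
  move=> ha.
  have <- : \sum_u x u * (if u \in W then a u else 0) = \sum_(u in W) x u * a u.
    rewrite [RHS]big_mkcond /=; apply: eq_bigr => u _.
    by case: ifP => //; rewrite mulr0.
  apply: hfrac => I sI.
  have -> : \sum_(u in I) (if u \in W then a u else 0) = \sum_(u in I :&: W) a u.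
    rewrite big_mkcond [RHS]big_mkcond /=; apply: eq_bigr => u _; rewrite inE.
    by case: (u \in I); case: (u \in W).
  apply: ha (subsetIr _ _) _ => u v; rewrite !inE => /andP[uI _] /andP[vI _].
  exact: sI.
(* For a random stable set, [X] is its mean size in [W] and [N v] the mean number of neighbours of
   [v] among its members in [W]. *)
pose X := \sum_(u in W) x u.
pose N v := \sum_(u in W) x u * (e v u)%:R.
have h1 (J : {set T}) : J \subset W -> stable e J -> \sum_(v in J) (N v - 1) <= X.
  move=> JW sJ.
  have := hfrac (fun u => (deg J u)%:R - 1) #|J|%:R.
  have -> : \sum_(u in W) x u * ((deg J u)%:R - 1) = \sum_(v in J) N v - X.
    rewrite /N /X exchange_big /= -sumrB; apply: eq_bigr => u _.
    rewrite mulrBr mulr1 -mulr_sumr /deg natr_sum; congr (_ * _ - _).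
    by apply: eq_bigr => v _; rewrite esym.
  rewrite sumrB -sum1_card natr_sum /= => h.
  suff : \sum_(v in J) N v - X <= \sum_(v in J) 1 by lra.
  apply: h => I IW sI; rewrite sumrB -!natr_sum.
  have := edges_stable_pair esym eirr ehf sI sJ.
  by rewrite -(ler_nat rat) natrD -!sum1_card !natr_sum; lra.
(* Averaging over the second stable set too would give $\sum x(N-1) \le X$, whereas $N \ge 5/2$
   makes the sum at least $3X/2$. *)
have := hfrac _ _ h1; apply/negP; rewrite -ltNge.
have hN v : v \in W -> 5 / 2 <= N v.
  move=> vW; apply: (@le_trans _ _ (\sum_(u in W) 5 / d%:R / 2 * (e v u)%:R)).
    rewrite -mulr_sumr -natr_sum.
    have : d%:R <= (deg W v)%:R :> rat by rewrite ler_nat hW.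
    rewrite /deg => h.
    have -> : 5 / 2 = 5 / d%:R / 2 * d%:R :> rat by field; lra.
    by apply: ler_wpM2l => //; rewrite !divr_ge0 // ltW.
  by apply: ler_sum => u uW; apply: ler_wpM2r => //; apply: hx.
have xpos v : v \in W -> 0 < x v.
  by move=> vW; apply: lt_le_trans (hx _ vW); rewrite !divr_gt0.
have X0 : 0 < X.
  have /set0Pn[v vW] := W0; rewrite /X (bigD1 v) //=.
  apply: ltr_pwDl; first exact: xpos.
  by apply: sumr_ge0 => u /andP[uW _]; apply/ltW/xpos.
apply: (@lt_le_trans _ _ (3 / 2 * X)); first lra.
rewrite /X mulr_sumr; apply: ler_sum => v vW.
by have := hN v vW; have := xpos v vW; nra.
Qed.

End DegeneracyBound.

(** In a degeneracy order, the earlier neighbours of a vertex form a set with cliques of size at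
    most [k], hence [D]-degenerate. So few of them have many neighbours there, which is what the
    process requires at rate $c=5/d$. *)
Lemma even_hole_free_degenerate k : {D | forall (T : finType) (e : rel T),
  symmetric e -> irreflexive e -> even_hole_free e ->
  forall S : {set T}, cliques_le e k S -> degenerate e D S}.
Proof.
elim: k => [|k [D IH]].
  exists 0 => T e esym eirr ehf S cS U US /set0Pn[v vU].
  have : #|[set v]| <= 0; last by rewrite cards1.
  apply: cS; first by rewrite sub1set (subsetP US).
  apply/forall_inP => x /set1P->; apply/forall_inP => y /set1P->.
  by rewrite eqxx.
(* The expected weighted load is at most $10+10$: $2cd=10$, and the bad neighbours add at most 10.
   This must not exceed $K/2$. *)
have [K KE] : {K : nat | K = 40} by exists 40.
have [M [M0 wM]] : {M : nat | 0 < M /\ wmax rat K = M%:R%R}.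
  by exists (2 ^ (4 * K).+1); split; rewrite ?expn_gt0 // natrX.
(* $d \ge 10M$ gives $cM \le 1/2$, and $d \ge 10M^2D$ gives $cM\cdot 20MD \le 10$. *)
exists (10 * M + 10 * M ^ 2 * D) => T e esym eirr ehf S cS U US U0.
apply/exists_inP; apply: contraT; rewrite negb_exists_in => /forall_inP hU.
have {}hU v : v \in U -> 10 * M + 10 * M ^ 2 * D < deg e U v.
  by move=> /hU; rewrite -ltnNge.
have [d [W [Nd WU W0 hW dW]]] := max_min_deg U0 hU.
have {hU} cW : cliques_le e k.+1 W.
  by apply: cliques_leW cS; apply: subset_trans US.
have [s [us sW so]] := degenerate_order esym dW.
have d0 : 0 < d by apply: leq_ltn_trans Nd.
have d1 : (0 < d%:R :> rat)%R by rewrite ltr0n.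
pose c : rat := (5 / d%:R)%R.
have c0 : (0 <= c)%R by rewrite divr_ge0 // ltW.
have cM (n : nat) : (c * M%:R * n%:R)%R = (5 * (M * n)%:R / d%:R)%R :> rat.
  by rewrite /c natrM; field; rewrite gt_eqF.
have c1 : (c * wmax rat K <= 2^-1)%R.
  rewrite wM; have := cM 1; rewrite mulr1 muln1 => ->; rewrite ler_pdivrMr //.
  have : ((10 * M)%:R <= d%:R :> rat)%R by rewrite ler_nat; lia.
  by rewrite natrM; lra.
pose B := d %/ (10 * M).
have hB : (B%:R * (c * wmax rat K) <= 2^-1)%R.
  rewrite wM mulrC cM ler_pdivrMr //.
  have : ((10 * M * B)%:R <= d%:R :> rat)%R.
    by rewrite ler_nat mulnC leq_trunc_div.
  by rewrite !natrM; lra.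
have hK : (2 * c * d%:R + c * wmax rat K * (20 * M * D)%:R <= K%:R / 2)%R.
  rewrite wM cM KE.
  have -> : (2 * c * d%:R = 10 :> rat)%R by rewrite /c; field; rewrite gt_eqF.
  suff : (5 * (M * (20 * M * D))%:R / d%:R <= 10 :> rat)%R by lra.
  rewrite ler_pdivrMr //.
  have : ((10 * M ^ 2 * D)%:R <= d%:R :> rat)%R by rewrite ler_nat; lia.
  by rewrite expnS expn1 !natrM; lra.
have K0 : 0 < K by rewrite KE.
have [|x [hx hfrac]] := @fractional_stable rat T e esym eirr c K c0 c1 s d
  (20 * M * D) B us K0 hB hK _; last first.
- exfalso; apply: (no_heavy_fractional_stable esym eirr ehf d0 W0 hW (x := x)) => //.
  by move=> v vW; apply: hx; rewrite -sW inE in vW.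
move=> s1 v s2 sE.
have us1 : uniq s1 by move: us; rewrite sE cat_uniq => /and3P[].
pose bad z := B < count (fun y => e y z && e y v) s1.
pose A := [set z in [seq z <- s1 | e z v]].
have uA : uniq [seq z <- s1 | e z v] by rewrite filter_uniq.
have cA : #|A| = count (fun z => e z v) s1.
  by rewrite cardsE (card_uniqP uA) size_filter.
exists bad; split; [by move=> z _ _; rewrite -leqNgt | | exact: so sE].
have AW : A \subset W.
  apply/subsetP => z; rewrite inE mem_filter -sW inE sE mem_cat => /andP[_ ->] //.
have dA : degenerate e D A.
  apply: (IH _ _ esym eirr ehf); apply: (cliques_le_nbr esym eirr cW (v := v)) => //.
    by rewrite -sW inE sE mem_cat mem_head orbT.
  by move=> u; rewrite inE mem_filter => /andP[].
have dB : d < B.+1 * (10 * M) by rewrite ltn_ceil // muln_gt0.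
have hd : #|A| <= d by rewrite cA; apply: so sE.
have := few_bad esym eirr dA hd dB (bad := bad).
have -> : #|[set z in A | bad z]| = count (fun z => e z v && bad z) s1.
  rewrite -size_filter -(card_uniqP _) ?filter_uniq // -[RHS]cardsE.
  by apply: eq_card => z; rewrite !inE !mem_filter; case: (e z v); case: (bad z); case: (z \in s1).
apply=> z zA; have -> // : deg e A z = count (fun y => e y z && e y v) s1.
by rewrite (deg_seq esym _ uA) count_filter; apply: eq_count.
Qed.

(** * Induced paths with prescribed ends *)

Section Paths.
Variables (T : finType) (e : rel T).
Hypotheses (esym : symmetric e) (eirr : irreflexive e).
Notation deg := (deg e).

(** Adjacency is equated with having consecutive indices, so one condition expresses both that [s]
    is a path and that it has no chords. *)
Definition ipath (s : seq T) :=
  uniq s && [forall u in s, forall v in s,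
    e u v == ((index u s).+1 == index v s) || ((index v s).+1 == index u s)].

Lemma ipathP s : reflect (uniq s /\ {in s &, forall u v,
    e u v = ((index u s).+1 == index v s) || ((index v s).+1 == index u s)})
  (ipath s).
Proof.
apply: (iffP andP) => -[us h]; split=> //.
  by move=> u v su sv; apply/eqP; move/forall_inP/(_ u su)/forall_inP: h; apply.
by apply/forall_inP=> u su; apply/forall_inP => v sv; apply/eqP/h.
Qed.

Lemma ipath_nth s x0 i j : ipath s -> i < size s -> j < size s ->
  e (nth x0 s i) (nth x0 s j) = (i.+1 == j) || (j.+1 == i).
Proof. by case/ipathP=> us h si sj; rewrite h ?mem_nth // !index_uniq. Qed.

Lemma ipath_catl s1 s2 : ipath (s1 ++ s2) -> ipath s1.
Proof.
case/ipathP; rewrite cat_uniq => /andP[us1 _] h; apply/ipathP; split=> // u v su sv.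
by rewrite h ?mem_cat ?su ?sv // !index_cat su sv.
Qed.

Lemma ipath_catr s1 s2 : ipath (s1 ++ s2) -> ipath s2.
Proof.
case/ipathP; rewrite cat_uniq => /and3P[_ /hasPn d us2] h.
apply/ipathP; split=> // u v su sv.
rewrite h ?mem_cat ?su ?sv ?orbT // !index_cat.
by rewrite (negbTE (d _ su)) (negbTE (d _ sv)) -!addnS !eqn_add2l.
Qed.

Lemma deg_gt1 (W : {set T}) v a b : a \in W -> b \in W -> a != b ->
  e v a -> e v b -> 1 < deg W v.
Proof.
move=> aW bW ab va vb; rewrite deg_card; apply/card_gt1P; exists a, b.
by rewrite !inE aW bW va vb.
Qed.

Lemma deg_inner (W : {set T}) s v : ipath s -> {subset s <= W} ->
  v \in s -> 0 < index v s -> (index v s).+1 < size s -> 1 < deg W v.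
Proof.
move=> ps sW vs i0 i1; have /ipathP[us _] := ps.
have i2 : (index v s).-1 < size s by lia.
apply: (@deg_gt1 _ _ (nth v s (index v s).-1) (nth v s (index v s).+1)).
- exact/sW/mem_nth.
- exact/sW/mem_nth.
- by rewrite nth_uniq //; lia.
- by rewrite -{1}(nth_index v vs) ipath_nth ?index_mem //; lia.
- by rewrite -{1}(nth_index v vs) ipath_nth ?index_mem //; lia.
Qed.

(* Two anticomplete paths of equal length would close up to an even hole; only
   the degrees and the 2-colouring of their union are needed. *)
Lemma path_pair_edge x y (p q : seq T) :
  even_hole_free e -> size p = size q -> 0 < size p ->
  ipath (x :: rcons p y) -> ipath (x :: rcons q y) -> ~~ has (mem p) q ->
  exists u v, [/\ u \in p, v \in q & e u v].
Proof.
move=> ehf szE sz0 pp pq dis.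
suff : [exists u in p, exists v in q, e u v].
  by case/exists_inP => u up /exists_inP[v vq euv]; exists u, v.
apply: contraT; rewrite negb_exists_in => /forall_inP nedge.
have {}nedge u v : u \in p -> v \in q -> e u v = false.
  move=> up vq; apply/negbTE.
  by have := nedge u up; rewrite negb_exists_in => /forall_inP; apply.
set sp := x :: rcons p y in pp; set sq := x :: rcons q y in pq.
have /ipathP[up hp] := pp; have /ipathP[uq hq] := pq.
have szp : size sp = (size p).+2 by rewrite /= size_rcons.
have szq : size sq = (size p).+2 by rewrite /= size_rcons szE.
have memp u : u \in sp = [|| u == x, u == y | u \in p].
  by rewrite inE mem_rcons inE.
have memq u : u \in sq = [|| u == x, u == y | u \in q].
  by rewrite inE mem_rcons inE.
have xy : x != y.
  by move: up; rewrite /= mem_rcons inE negb_or => /andP[/andP[]].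
have idx s : index x (x :: rcons s y) = 0 by rewrite /= eqxx.
have idy s : uniq (x :: rcons s y) -> index y (x :: rcons s y) = (size s).+1.
  rewrite /= rcons_uniq => /and3P[_ ys _]; rewrite (negbTE xy).
  by rewrite -cats1 index_cat (negbTE ys) /= eqxx addn0.
have pnq u : u \in p -> u \notin q.
  by move=> pu; apply: contra dis => qu; apply/hasP; exists u.
have inp u : u \in p -> 0 < index u sp /\ (index u sp).+1 < size sp.
  move=> pu; have /= := up; rewrite rcons_uniq mem_rcons inE negb_or.
  case/andP=> /andP[_ xp] _.
  have xu : x != u by apply: contraNneq xp => ->.
  by rewrite /= (negbTE xu) size_rcons -cats1 index_cat pu !ltnS index_mem.
have inq u : u \in q -> 0 < index u sq /\ (index u sq).+1 < size sq.
  move=> qu; have /= := uq; rewrite rcons_uniq mem_rcons inE negb_or.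
  case/andP=> /andP[_ xq] _.
  have xu : x != u by apply: contraNneq xq => ->.
  by rewrite /= (negbTE xu) size_rcons -cats1 index_cat qu !ltnS index_mem.
pose W := [set u in sp] :|: [set u in sq].
have spW : {subset sp <= W} by move=> u us; rewrite in_setU !in_set us.
have sqW : {subset sq <= W} by move=> u us; rewrite in_setU !in_set us orbT.
(* The parity is consistent at the shared ends because both paths have the same length. *)
pose col u := if u \in sp then odd (index u sp) else odd (index u sq).
have colq u : u \in sq -> col u = odd (index u sq).
  rewrite /col; case: ifP => // us; rewrite memq => /or3P[/eqP->|/eqP->|qu].
  - by rewrite !idx.
  - by rewrite !idy // szE.
  - move: us; rewrite memp => /or3P[/eqP->|/eqP->|/pnq]; last by rewrite qu.
      by rewrite !idx.
    by rewrite !idy // szE.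
have W0 : W != set0 by apply/set0Pn; exists x; apply: spW; rewrite mem_head.
have [|v vW] := @bipartite_deg_le1 T e esym eirr W col ehf W0.
  have odd_succ i j : (i.+1 == j) || (j.+1 == i) -> odd i != odd j.
    by case/orP=> /eqP <- /=; case: (odd _).
  have both u v : u \in p -> v \in q -> e u v -> col u != col v.
    by move=> pu qv; rewrite nedge.
  move=> u v; rewrite !in_setU !in_set => uW vW euv.
  case upp : (u \in sp); case vpp : (v \in sp).
  - by rewrite /col upp vpp; apply: odd_succ; rewrite -hp.
  - have vq : v \in sq by move: vW; rewrite vpp.
    case uqq : (u \in sq); first by rewrite !colq //; apply: odd_succ; rewrite -hq.
    move: upp uqq vpp vq; rewrite !memp !memq.
    case: (u == x) => //; case: (u == y) => //; case: (v == x) => //.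
    by case: (v == y) => //= pu _ _ qv; apply: both.
  - have uq' : u \in sq by move: uW; rewrite upp.
    case vqq : (v \in sq); first by rewrite !colq //; apply: odd_succ; rewrite -hq.
    move: upp uq' vpp vqq; rewrite !memp !memq.
    case: (v == x) => //; case: (v == y) => //; case: (u == x) => //.
    by case: (u == y) => //= _ qu pv _; rewrite eq_sym; apply: both; rewrite // esym.
  - rewrite !colq; first by apply: odd_succ; rewrite -hq //; move: uW vW; rewrite upp vpp.
      by move: vW; rewrite vpp.
    by move: uW; rewrite upp.
(* Every degree in [W] is at least 2: an end has one neighbour on each path, an inner vertex two on
   its own. *)
apply: contraTT => _; rewrite -ltnNge.
have nth1 s : nth x (x :: s) 0 = x by [].
have nthy (s : seq T) : nth x (x :: rcons s y) (size s).+1 = y.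
  by rewrite /= nth_rcons ltnn eqxx.
have inner (s : seq T) i : 0 < i -> i <= size s -> nth x (x :: rcons s y) i \in s.
  by case: i => // i _ si; rewrite /= nth_rcons si mem_nth.
have ends i : 0 < i -> i <= size p -> nth x sp i != nth x sq i.
  move=> i0 i1; apply/eqP => h; have := inner p i i0 i1; rewrite h => /pnq.
  by rewrite inner // -szE.
have vcase : [|| v == x, v == y, v \in p | v \in q].
  by move: vW; rewrite in_setU !in_set memp memq; do !case: (_ == _); case: (_ \in _); case: (_ \in _).
case/or4P: vcase => [/eqP->|/eqP->|pv|qv].
- apply: (@deg_gt1 _ _ (nth x sp 1) (nth x sq 1)).
  + by apply/spW/mem_nth; rewrite szp.
  + by apply/sqW/mem_nth; rewrite szq.
  + exact: ends.
  + by rewrite -{1}(nth1 (rcons p y)) ipath_nth // szp.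
  + by rewrite -{1}(nth1 (rcons q y)) ipath_nth // szq.
- apply: (@deg_gt1 _ _ (nth x sp (size p)) (nth x sq (size p))).
  + by apply/spW/mem_nth; rewrite szp.
  + by apply/sqW/mem_nth; rewrite szq.
  + exact: ends.
  + by rewrite -{1}(nthy p) ipath_nth // ?szp // eqxx orbT.
  + by rewrite -{1}(nthy q) ipath_nth // ?szq ?szE // eqxx orbT.
- by have [] := inp v pv; apply: (deg_inner pp spW) => //; rewrite memp pv !orbT.
- by have [] := inq v qv; apply: (deg_inner pq sqW) => //; rewrite memq qv !orbT.
Qed.

Definition paths l x y := [set p : l.-tuple T | ipath (x :: rcons p y)].

Lemma card_bigcup_le (I U : finType) (A : {set I}) (F : I -> {set U}) n :
  (forall i, i \in A -> #|F i| <= n) -> #|\bigcup_(i in A) F i| <= #|A| * n.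
Proof.
move=> hF; rewrite -sum_nat_const.
apply: (@leq_trans (\sum_(i in A) #|F i|)); last exact: leq_sum.
apply: (big_ind2 (fun (X : {set U}) m => #|X| <= m)); rewrite ?cards0 //.
move=> X m Y m' hX hY; have [le _] := leq_card_setU X Y.
by apply: leq_trans le _; apply: leq_add.
Qed.

(* [P] is a maximal packing of disjoint interiors; its members are pairwise
   joined by edges, so degeneracy bounds their number. *)
Lemma paths_hitting_set D l x y : 0 < l ->
  even_hole_free e -> degenerate e D [set: T] ->
  exists U : {set T}, #|U| <= l * (2 * D * l).+1 /\
    forall p, p \in paths l x y -> has (mem U) p.
Proof.
move=> l0 ehf dT.
pose inn (p : l.-tuple T) : {set T} := [set u in p].
pose packing (P : {set {set T}}) :=
  (P \subset [set inn p | p in paths l x y]) && trivIset P.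
have pack0 : packing set0.
  by rewrite /packing sub0set; apply/trivIsetP => A B; rewrite inE.
have [P /maxsetP[/andP[Psub Ptriv] Pmax] _] := maxset_exists pack0.
have cardP A : A \in P -> #|A| = l.
  move=> /(subsetP Psub)/imsetP[p]; rewrite inE => /andP[us _] ->.
  rewrite cardsE (card_uniqP _) ?size_tuple //.
  by move: us; rewrite /= rcons_uniq => /and3P[].
have cardU : #|cover P| = #|P| * l.
  by rewrite -(eqP Ptriv) (eq_bigr (fun=> l)) ?sum_nat_const.
exists (cover P); split; last first.
  move=> p ph; apply: contraT => /hasPn hp.
  have dis A : A \in P -> [disjoint inn p & A].
    move=> AP; rewrite -setI_eq0; apply/eqP/setP => u; rewrite !inE.
    apply/negbTE/negP => /andP[/hp /negP + uA]; apply.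
    by apply/bigcupP; exists A.
  (* Maximality puts the interior of an unhit path into the packing; it is then disjoint from
     itself, although it has $l > 0$ vertices. *)
  have inP : inn p \in P.
    have <- : inn p |: P = P; last by rewrite !inE eqxx.
    apply: Pmax; last exact: subsetUr.
    rewrite /packing subUset sub1set Psub imset_f //=.
    apply/trivIsetP => A B /setU1P[->|AP] /setU1P[->|BP] AB.
    - by rewrite eqxx in AB.
    - exact: dis.
    - by rewrite disjoint_sym dis.
    - by move/trivIsetP: Ptriv; apply.
  have := dis _ inP; rewrite -setI_eq0 setIid -cards_eq0 cardP //.
  by rewrite eqn0Ngt l0.
rewrite cardU mulnC leq_mul2l; apply/orP; right.
have h1 := sum_deg_degenerate esym eirr (degenerateW (subsetT (cover P)) dT).
(* Each ordered pair of members contributes an edge; against the degree sum at most $2D|P|l$ this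
   leaves $|P| \le 2Dl+1$. *)
suff h2 : #|P| * #|P|.-1 <= \sum_(u in cover P) deg (cover P) u.
  rewrite cardU in h1; have {h1 h2} := leq_trans h2 h1.
  case: #|P| => // n; rewrite ltnS /= => h.
  by rewrite -(leq_pmul2l (ltn0Sn n)); nia.
rewrite big_trivIset //= -sum_nat_const; apply: leq_sum => A AP.
have -> : #|P|.-1 = \sum_(B in P :\ A) 1 by rewrite sum1_card (cardsD1 A P) AP.
have -> : \sum_(u in A) deg (cover P) u
    = \sum_(B in P) \sum_(u in A) \sum_(v in B) e u v.
  rewrite [RHS]exchange_big; apply: eq_bigr => u _.
  by rewrite /deg big_trivIset.
rewrite [X in _ <= X](big_setD1 A) //=; apply: leq_trans (leq_addl _ _).
apply: leq_sum => B; rewrite !inE => /andP[BA BP].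
have /imsetP[p php Ap] := subsetP Psub _ AP.
have /imsetP[q qhq Bq] := subsetP Psub _ BP.
have dis : ~~ has (mem p) q.
  apply/negP => /hasP[u uq up].
  have := trivIsetP Ptriv _ _ BP AP BA; rewrite -setI_eq0 => /eqP/setP/(_ u).
  by rewrite Ap Bq !inE uq; move: up => /= ->.
rewrite !inE in php qhq.
have [||u [v [up vq euv]]] := path_pair_edge ehf _ _ php qhq dis; rewrite ?size_tuple //.
by rewrite (bigD1 u) ?Ap ?inE //= (bigD1 v) ?Bq ?inE //= euv -!addnA.
Qed.

(** Cutting at [u] gives two induced paths, with [i] and $l-i-1$ inner vertices, which together
    determine the original. *)
Lemma card_paths_through l x y u (i : 'I_l) C :
  (forall l' a b, l' < l -> #|paths l' a b| <= C) ->
  #|[set p in paths l x y | tnth p i == u]| <= C * C.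
Proof.
move=> hC.
pose f (p : l.-tuple T) := ([tuple of take i p], [tuple of drop i.+1 p]).
have split_p (p : l.-tuple T) : tnth p i = u ->
    tval p = take i p ++ u :: drop i.+1 p.
  move=> pu; rewrite -[LHS](cat_take_drop i) (drop_nth u) ?size_tuple //.
  by rewrite -(tnth_nth u) pu.
set A := [set p in _ | _].
have finj : {in A &, injective f}.
  move=> p q; rewrite !inE => /andP[_ /eqP pu] /andP[_ /eqP qu] [h1 h2].
  by apply: val_inj; rewrite [LHS](split_p p pu) [RHS](split_p q qu) h1 h2.
rewrite -(card_in_imset finj).
apply: (@leq_trans #|setX (paths (minn i l) x u) (paths (l - i.+1) u y)|).
  apply/subset_leq_card/subsetP => _ /imsetP[p + ->].
  rewrite !inE => /andP[pp /eqP pu]; rewrite (split_p p pu) in pp.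
  apply/andP; split=> /=.
    apply: (ipath_catl (s2 := rcons (drop i.+1 p) y)).
    by rewrite /= cat_rcons -rcons_cons -rcons_cat.
  apply: (ipath_catr (s1 := x :: take i p)).
  by rewrite /= -rcons_cons -rcons_cat.
rewrite cardsX; apply: leq_mul; apply: hC; have := ltn_ord i; lia.
Qed.

End Paths.

Lemma paths_bounded D l : {C | forall (T : finType) (e : rel T),
  symmetric e -> irreflexive e -> even_hole_free e -> degenerate e D [set: T] ->
  forall l' x y, l' < l -> #|paths e l' x y| <= C}.
Proof.
elim: l => [|l [C IH]]; first by exists 0.
(* [C] covers shorter paths and 1 the empty interior; the last term counts a hitting vertex, its
   position and the two halves. *)
exists (C + 1 + l * (2 * D * l).+1 * (l * (C * C))).
move=> T e esym eirr ehf dT l' x y; rewrite ltnS leq_eqVlt => /orP[/eqP->|lt]; last first.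
  by apply: leq_trans (IH _ _ esym eirr ehf dT _ x y lt) _; rewrite -addnA leq_addr.
have [->|l0] := posnP l.
  apply: leq_trans (max_card _) _; rewrite card_tuple expn0; lia.
have [U [cU hU]] := paths_hitting_set esym eirr x y l0 ehf dT.
apply: leq_trans (leq_addl _ _).
apply: (@leq_trans #|\bigcup_(u in U) \bigcup_(i in [set: 'I_l])
    [set p in paths e l x y | tnth p i == u]|).
  apply/subset_leq_card/subsetP => p pp.
  have /hasP[u up uU] := hU p pp; have /tnthP[i ui] := up.
  apply/bigcupP; exists u => //; apply/bigcupP; exists i; rewrite ?inE //.
  by rewrite -ui eqxx andbT; move: pp; rewrite inE.
apply: (@leq_trans (#|U| * (l * (C * C)))); last by rewrite leq_mul2r cU orbT.
apply: card_bigcup_le => u _.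
have -> : l * (C * C) = #|[set: 'I_l]| * (C * C) by rewrite cardsT card_ord.
apply: card_bigcup_le => i _.
by apply: card_paths_through => k a b; apply: IH.
Qed.

(** * Counting holes *)

Section Holes.
Variables (T : finType) (e : rel T).
Hypotheses (esym : symmetric e) (eirr : irreflexive e).
Notation deg := (deg e).

(** Rotate the cycle to start at [v]: the rest is an induced path whose ends [x], [y] are the
    neighbours of [v], leaving $|S|-3$ inner vertices. *)
Lemma hole_through (S : {set T}) v : is_hole e S -> v \in S ->
  exists x y (p : (#|S| - 3).-tuple T),
    [/\ e v x, e v y, p \in paths e (#|S| - 3) x y &
        S = [set u in v :: x :: rcons p y]].
Proof.
case/andP=> S4 /existsP[c /and3P[/eqP cS /andP[cyc uc] /forall_inP ch]] vS.
have memc u : (u \in c) = (u \in S) by move/setP/(_ u): cS; rewrite inE.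
have vc : v \in c by rewrite memc.
have [i s rs] := rot_to vc.
have us : uniq (v :: s) by rewrite -rs rot_uniq.
have cys : cycle e (v :: s) by rewrite -rs rot_cycle.
have szs : size s = #|S|.-1 by rewrite -[size s]/(size (v :: s)).-1 -rs size_rot size_tuple.
have memS u : (u \in S) = (u \in v :: s) by rewrite -rs mem_rot memc.
have {}ch : {in s &, forall a b, e a b = (next (v :: s) a == b) || (next (v :: s) b == a)}.
  move=> a b sa sb; apply/idP/idP.
    move=> eab; rewrite -rs !next_rot //.
    have aS : a \in S by rewrite memS inE sa orbT.
    have bS : b \in S by rewrite memS inE sb orbT.
    by have /forall_inP/(_ b bS)/implyP := ch a aS; apply.
  by case/orP=> /eqP <-; [|rewrite esym]; apply: next_cycle => //; rewrite inE ?sa ?sb orbT.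
(* The default [v] is the right value at the end of [s], where the cycle returns to [v]. *)
have nxt a : a \in s -> next (v :: s) a = nth v s (index a s).+1.
  move=> sa; have va : v != a.
    by apply: contraTneq us => ->; rewrite /= sa.
  by rewrite next_nth inE sa orbT /= (negbTE va).
have nxtE a b : a \in s -> b \in s ->
    (next (v :: s) a == b) = ((index a s).+1 == index b s).
  move=> sa sb; rewrite nxt //; have /andP[vs us'] := us.
  have [lt|ge] := ltnP (index a s).+1 (size s).
    by rewrite -{1}(nth_index v sb) nth_uniq // index_mem.
  rewrite nth_default //; have := sb; rewrite -index_mem => lt.
  have -> : (v == b) = false by apply: contraNF vs => /eqP->.
  by symmetry; apply/negbTE; rewrite neq_ltn (leq_trans lt ge) orbT.
have ps : ipath e s.
  apply/ipathP; split; first by case/andP: us.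
  by move=> a b sa sb; rewrite ch // !nxtE.
case: s => [|x s] in rs us cys szs memS ch nxt nxtE ps *; first by rewrite /= in szs; lia.
case/lastP: s => [|s y] in rs us cys szs memS ch nxt nxtE ps *.
  by rewrite /= in szs; lia.
have sz3 : size s == #|S| - 3.
  have ar (m n : nat) : m.+2 = n.-1 -> m = n - 3 by lia.
  by rewrite /= size_rcons in szs; apply/eqP/ar.
exists x, y, (Tuple sz3); split.
- by move: cys => /= /andP[].
- by move: cys; rewrite /= rcons_path last_rcons (esym y) => /and3P[].
- by rewrite inE.
- by apply/setP => u; rewrite memS inE.
Qed.

Definition holes_in g (W : {set T}) :=
  [set S : {set T} | [&& S \subset W, is_hole e S & #|S| == g]].

(** Such a hole is determined by the two neighbours of [v] on it and the induced path joining
    them. *)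
Lemma card_holes_through g (W : {set T}) v C :
  (forall x y, #|paths e (g - 3) x y| <= C) ->
  #|[set S in holes_in g W | v \in S]| <= deg W v * (deg W v * C).
Proof.
move=> hC; rewrite !deg_card; set N := [set u in W | e v u].
pose F x y := [set [set u in v :: x :: rcons (p : (g - 3).-tuple T) y] | p in paths e (g - 3) x y].
apply: (@leq_trans #|\bigcup_(x in N) \bigcup_(y in N) F x y|).
  apply/subset_leq_card/subsetP => S; rewrite !inE => /andP[/and3P[SW hS /eqP Sg] vS].
  have [x [y [p]]] := hole_through hS vS; rewrite Sg in p * => -[vx vy pp SE].
  have inS u : u \in v :: x :: rcons p y -> u \in W.
    by move=> us; apply: (subsetP SW); rewrite SE inE.
  apply/bigcupP; exists x; first by rewrite inE vx inS // !inE eqxx orbT.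
  apply/bigcupP; exists y.
    by rewrite inE vy inS // !inE mem_rcons mem_head !orbT.
  by apply/imsetP; exists p.
apply: card_bigcup_le => x _; apply: card_bigcup_le => y _.
exact: leq_trans (leq_imset_card _ _) (hC x y).
Qed.

Lemma card_holes g D C (W : {set T}) : degenerate e D W ->
  (forall x y, #|paths e (g - 3) x y| <= C) ->
  #|holes_in g W| <= D * (D * C) * #|W|.
Proof.
move=> dW hC; have [n leWn] := ubnP #|W|; elim: n W leWn dW => // n IH W leWn dW.
have [-> | W0] := eqVneq W set0.
  rewrite cards0 muln0 leqn0 cards_eq0; apply/eqP/setP => S; rewrite !inE subset0.
  by apply/negP => /and3P[/eqP-> /andP[]]; rewrite cards0.
have [v vW degv] := dW W (subxx _) W0.
have cW := cardsD1 v W; rewrite vW in cW.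
have lt : #|W :\ v| < n by move: leWn; rewrite cW.
have {}IH := IH _ lt (degenerateW (subsetDl _ _) dW).
have sub : holes_in g W \subset holes_in g (W :\ v) :|: [set S in holes_in g W | v \in S].
  apply/subsetP => S; rewrite !inE => /and3P[SW -> ->]; rewrite SW !andbT /=.
  by case vS : (v \in S); rewrite ?orbT // subsetD1 SW vS.
apply: leq_trans (subset_leq_card sub) _.
have [le _] := leq_card_setU (holes_in g (W :\ v)) [set S in holes_in g W | v \in S].
apply: leq_trans le _; rewrite cW mulnDr muln1 addnC.
apply: leq_add => //; apply: leq_trans (card_holes_through W v hC) _.
by apply: leq_mul => //; apply: leq_mul.
Qed.

End Holes.

Theorem theorem6 :
  exists phi : int -> nat -> nat,
    forall (g : int) (T : finType) (e : rel T),
      symmetric e -> irreflexive e -> 0 < #|T| -> even_hole_free e ->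
      num_holes e g <= phi g (clique_number e) * #|T|.
Proof.
pose D k := sval (even_hole_free_degenerate k).
(* The successor is there because [paths_bounded] covers strictly smaller numbers of inner
   vertices. *)
pose C d n := sval (paths_bounded d (n - 3).+1).
exists (fun g k => if g is Posz n then D k * (D k * C (D k) n) else 0).
move=> g T e esym eirr _ ehf.
have dT : degenerate e (D (clique_number e)) [set: T].
  apply: (svalP (even_hole_free_degenerate _)) => // Q _ clQ.
  exact: (leq_bigmax_cond (F := fun Q : {set T} => #|Q|)).
case: g => [n|n]; last first.
  by rewrite mul0n leqn0 cards_eq0; apply/eqP/setP => S; rewrite !inE andbF.
have -> : num_holes e n = #|holes_in e n [set: T]|.
  by apply: eq_card => S; rewrite !inE subsetT.
rewrite -cardsT; apply: card_holes => // x y.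
exact: (svalP (paths_bounded _ _)).
Qed.
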